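(* Let $P$ be a Poisson algebra over a field $\mathbb{F}$ of characteristic $p\geq 0$. Then: (1) If $P$ is solvable and $p\neq 2$, then $\{P,P\}P$ is a nil ideal. (2) If $P$ is solvable and $p\geq 3$, then $\{P,P\}P$ is nil of bounded index. (3) If $P$ is Lie nilpotent and $p>0$, then $\{P,P\}P$ is nil of bounded index.
   Context: A Poisson algebra $P$ over a field $\mathbb{F}$ is a commutative associative $\mathbb{F}$-algebra with unity equipped with a Lie bracket $\{\,,\}$ (bilinear over $\mathbb{F}$) satisfying the Leibniz rule $\{a\cdot b,c\}=a\cdot\{b,c\}+b\cdot\{a,c\}$ for all $a,b,c\in P$. For subspaces $A,B$, $\{A,B\}$ denotes the linear span of all $\{a,b\}$ with $a\in A$, $b\in B$, and $AB$ the linear span of all products $ab$; thus $\{P,P\}P$ is the ideal generated by all brackets, and it is a Poisson ideal (an ideal for both the associative product and the bracket). $P$ is solvable if it is solvable as a Lie algebra, and Lie nilpotent if it is nilpotent as a Lie algebra. A Poisson ideal $I$ is nil if every element of $I$ is nilpotent with respect to the associative product, and nil of bounded index if there is a positive integer $r$ with $x^r=0$ for all $x\in I$. *)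

(* Defs.v *)
From HB Require Import structures.
From mathcomp Require Import all_boot all_order all_algebra.
From mathcomp Require Import classical_sets.

Set Implicit Arguments.
Unset Strict Implicit.
Unset Printing Implicit Defensive.

Import GRing.Theory.
Local Open Scope classical_set_scope.
Local Open Scope ring_scope.

(* The Lie bracket is alternating, [pbr a a = 0]; antisymmetry alone would be
   too weak over a field of characteristic 2. *)
HB.mixin Record isPoisson (F : fieldType) P of GRing.ComAlgebra F P := {
  pbr : P -> P -> P;
  pbr_bilinear : bilinear_for *:%R *:%R pbr;
  pbr_alt : forall a, pbr a a = 0;
  pbr_jacobi : forall a b c,
    pbr a (pbr b c) + pbr b (pbr c a) + pbr c (pbr a b) = 0;
  pbr_leibniz : forall a b c,
    pbr (a * b) c = a * pbr b c + b * pbr a c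
}.

#[short(type="poissonAlgType")]
HB.structure Definition Poisson (F : fieldType) :=
  {P of GRing.ComAlgebra F P & isPoisson F P}.

Definition has_pchar (F : fieldType) (p : nat) : Prop :=
  if p is 0%N then [pchar F] =i pred0 else p \in [pchar F].

Section PoissonAlgebra.
Variables (F : fieldType) (P : poissonAlgType F).
Implicit Types A B I : set P.

Definition lspan A : set P :=
  [set x | exists (n : nat) (c : 'I_n -> F) (v : 'I_n -> P),
     (forall i, A (v i)) /\ x = \sum_(i < n) c i *: v i].

Definition pbr_space A B : set P := lspan [set pbr a b | a in A & b in B].

Definition mul_space A B : set P := lspan [set a * b | a in A & b in B].

Fixpoint derived_series (n : nat) : set P :=
  if n is m.+1 then pbr_space (derived_series m) (derived_series m)
  else [set: P].

Fixpoint lower_central_series (n : nat) : set P :=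
  if n is m.+1 then pbr_space (lower_central_series m) [set: P]
  else [set: P].

Definition poisson_solvable : Prop := exists n, derived_series n = [set 0].

Definition lie_nilpotent : Prop := exists n, lower_central_series n = [set 0].

Record poisson_ideal I : Prop := PoissonIdeal {
  poisson_ideal0 : I 0;
  poisson_ideal_linear : forall (k : F) x y, I x -> I y -> I (k *: x + y);
  poisson_ideal_mul : forall a x, I x -> I (a * x);
  poisson_ideal_pbr : forall a x, I x -> I (pbr a x)
}.

Definition nil_ideal I : Prop :=
  poisson_ideal I /\ forall x, I x -> exists r : nat, (0 < r)%N /\ x ^+ r = 0.

Definition nil_bounded_index I : Prop :=
  poisson_ideal I /\
  exists r : nat, (0 < r)%N /\ forall x, I x -> x ^+ r = 0.

Definition pbr_ideal : set P := mul_space (pbr_space [set: P] [set: P]) [set: P].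

End PoissonAlgebra.

Arguments poisson_solvable {F} P.
Arguments lie_nilpotent {F} P.
Arguments pbr_ideal {F} P.

(* Main.v *)
Require Import Defs.
From mathcomp Require Import all_boot all_order all_algebra.
From mathcomp Require Import classical_sets.

(** Write [S k] for the [k]-th term of the derived series (solvable case) or of
    the lower central series (nilpotent case), and [J k] for the associative
    ideal generated by the brackets [pbr a x] with [a] in [S k]. Then [J 0] is
    the ideal of the theorem, and [J n = 0] as soon as [S n = 0]. So it suffices
    that each [J k] be nil modulo [J k.+1], uniformly in characteristic [p]; and
    this has to be checked on the generators [pbr a x] only, since the elements
    that are nilpotent modulo an ideal form an ideal, as do, in characteristic
    [p], those whose [p]-th power lies in that ideal.

    The generators are treated by bracketing with the product [a * x]. All
    computations below are modulo [J k.+1], where [S k.+1] becomes central.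
    - Lower central series ([pbr_sqr_mod_center]): [pbr a (a * x)] is both
      central and equal to [a * pbr a x] with [pbr a x] central; bracketing it
      with [z] leaves [pbr a x * pbr a z = 0]. Hence [pbr a x ^+ 2 = 0].
    - Derived series ([pbr_cube_mod_center]): with [D := pbr a], the image of
      [D^2] lies in [S k.+1], because [S k] is a Lie ideal, hence is central.
      The same argument applied to [D^2 (a * x) = a * D^2 x] gives
      [D^2 x * D z = 0]. Multiplying
      [D^2 (x * x) = 2 (x * D^2 x + D x ^+ 2)] by [D x] then leaves
      [2 (D x) ^+ 3 = 0], so that [D x ^+ 3 = 0] when 2 is invertible.

    The exponents 2 and 3 are at most [p] in the cases where a bounded index is
    claimed, so [x ^+ p] is in [J k.+1] for all [x] in [J k], and
    [x ^+ (p ^ n) = 0] on [J 0]. *)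

Section NilBrackets.

Import GRing.Theory.
Local Open Scope classical_set_scope.
Local Open Scope ring_scope.

Context {F : fieldType} {P : poissonAlgType F}.
Implicit Types (A B I L : set P) (a b c x y z : P).

(** * Brackets and linear spans *)

Lemma pbrDl a b c : pbr (a + b) c = pbr a c + pbr b c.
Proof.
by have := (pbr_bilinear (F := F)).1 c 1 a b; rewrite /= !scale1r.
Qed.

Lemma pbrDr a b c : pbr c (a + b) = pbr c a + pbr c b.
Proof.
by have := (pbr_bilinear (F := F)).2 c 1 a b; rewrite /= !scale1r.
Qed.

Lemma pbr0l c : pbr 0 c = 0 :> P.
Proof. by apply: (addrI (pbr 0 c)); rewrite -pbrDl !addr0. Qed.

Lemma pbr0r c : pbr c 0 = 0 :> P.
Proof. by apply: (addrI (pbr c 0)); rewrite -pbrDr !addr0. Qed.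

Lemma pbrZl (k : F) a c : pbr (k *: a) c = k *: pbr a c.
Proof.
by have := (pbr_bilinear (F := F)).1 c k a 0; rewrite /= pbr0l !addr0.
Qed.

Lemma pbrC a b : pbr a b = - pbr b a.
Proof.
apply/eqP; rewrite -addr_eq0; apply/eqP.
by have := pbr_alt (a + b); rewrite pbrDl !pbrDr !pbr_alt add0r addr0.
Qed.

Lemma pbrNr a b : pbr a (- b) = - pbr a b.
Proof. by apply/eqP; rewrite -addr_eq0 -pbrDr addNr pbr0r. Qed.

Lemma pbrMr a b c : pbr c (a * b) = a * pbr c b + b * pbr c a.
Proof. by rewrite pbrC pbr_leibniz opprD -!mulrN -!(pbrC c). Qed.

(** The Jacobi identity in the form used for Lie ideals: bracketing with [z] is
    a derivation of the bracket. *)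
Lemma pbr_jacobi_der a b z : pbr (pbr a b) z = pbr (pbr a z) b + pbr a (pbr b z).
Proof.
have := pbr_jacobi a b z; rewrite (pbrC z a) pbrNr (pbrC b (pbr a z)) (pbrC z) opprK.
by move=> /eqP; rewrite subr_eq0 addrC => /eqP.
Qed.

Definition linear_subset I :=
  I 0 /\ forall (k : F) x y, I x -> I y -> I (k *: x + y).

Lemma lspan_linear A : linear_subset (lspan A).
Proof.
split; first by exists 0%N, (fun=> 0), (fun=> 0); split=> [[]|]; rewrite ?big_ord0.
move=> k _ _ [n [c [v [Av ->]]]] [m [d [w [Aw ->]]]].
exists (n + m)%N, (fun i => match split i with inl j => k * c j | inr j => d j end),
  (fun i => match split i with inl j => v j | inr j => w j end).
split=> [i|]; first by case: split.
rewrite big_split_ord /= scaler_sumr; congr (_ + _); apply: eq_bigr => i _.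
  by rewrite (unsplitK (inl i)) scalerA.
by rewrite (unsplitK (inr i)).
Qed.

Lemma sub_lspan A : A `<=` lspan A.
Proof.
move=> x Ax; exists 1%N, (fun=> 1), (fun=> x); split=> //.
by rewrite big_ord1 scale1r.
Qed.

Lemma lspan_min A I : linear_subset I -> A `<=` I -> lspan A `<=` I.
Proof.
move=> [I0 Ilin] AI _ [n [c [v [Av ->]]]].
elim/big_rec: _ => // i x _ Ix; apply: Ilin => //; exact: AI.
Qed.

Lemma pbr_space_min A B I : linear_subset I ->
  (forall a b, A a -> B b -> I (pbr a b)) -> pbr_space A B `<=` I.
Proof.
by move=> Ilin ABI; apply: lspan_min => // _ [a Aa [b Bb <-]]; apply: ABI.
Qed.

Lemma mem_pbr_space A B a b : A a -> B b -> pbr_space A B (pbr a b).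
Proof. by move=> Aa Bb; apply: sub_lspan; exists a => //; exists b. Qed.

(** * Associative ideals and their radicals *)

Record assoc_ideal I : Prop := AssocIdeal {
  assoc_ideal0 : I 0;
  assoc_idealD : forall x y, I x -> I y -> I (x + y);
  assoc_idealM : forall a x, I x -> I (a * x)
}.

Section AssocIdealTheory.
Variables (I : set P) (idI : assoc_ideal I).

Lemma assoc_idealMr x a : I x -> I (x * a).
Proof. by rewrite mulrC; apply: assoc_idealM. Qed.

Lemma assoc_idealZ (k : F) x : I x -> I (k *: x).
Proof. by rewrite -mulr_algl; apply: assoc_idealM. Qed.

Lemma assoc_ideal_linear : linear_subset I.
Proof.
split=> [|k x y Ix Iy]; first exact: assoc_ideal0.
by apply: assoc_idealD => //; apply: assoc_idealZ.
Qed.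

Lemma assoc_idealBr x y : I (x + y) -> I y -> I x.
Proof.
move=> Ixy Iy; rewrite -(addrK y x) -mulN1r.
by apply: assoc_idealD => //; apply: assoc_idealM.
Qed.

Lemma assoc_idealX x m n : (m <= n)%N -> I (x ^+ m) -> I (x ^+ n).
Proof. by move=> /subnK <- Ix; rewrite exprD; apply: assoc_idealM. Qed.

End AssocIdealTheory.

Lemma zero_assoc_ideal : assoc_ideal [set 0].
Proof.
by split=> [|x y -> ->|a x ->]; rewrite /= ?addr0 ?mulr0.
Qed.

Definition radical I : set P := [set x | exists r : nat, I (x ^+ r)].

Lemma radical_ideal I : assoc_ideal I -> assoc_ideal (radical I).
Proof.
move=> idI; split=> [|x y [r Ir] [s Is]|a x [r Ir]].
- by exists 1%N; apply: assoc_ideal0.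
- exists (r + s)%N; rewrite exprDn.
  apply: (big_ind I) => [||i _]; [exact: assoc_ideal0|exact: assoc_idealD|].
  rewrite -mulr_natl; apply: assoc_idealM => //.
  (* Either [x] has exponent at least [r], or [y] has exponent at least [s]. *)
  have [le_is|lt_si] := leqP i s.
    apply: assoc_idealMr => //; apply: assoc_idealX Ir => //.
    by rewrite -addnBA // leq_addr.
  by apply: assoc_idealM => //; apply: assoc_idealX Is => //; apply: ltnW.
- by exists r; rewrite exprMn; apply: assoc_idealM.
Qed.

(** The power map [x |-> x ^+ p] is additive, being the Frobenius endomorphism. *)
Lemma frobenius_preimage_ideal p I : p \in [pchar F] ->
  assoc_ideal I -> assoc_ideal [set x | I (x ^+ p)].
Proof.
move=> Fp idI; have pP : p \in [pchar P] by rewrite pchar_lalg.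
have p_gt0 : (0 < p)%N by apply/prime_gt0/(pcharf_prime Fp).
split=> [|x y Ix Iy|a x Ix] /=.
- by rewrite expr0n eqn0Ngt p_gt0; apply: assoc_ideal0.
- rewrite -(pFrobenius_autE pP) pFrobenius_autD_comm; last exact: mulrC.
  by rewrite !pFrobenius_autE; apply: assoc_idealD.
- by rewrite exprMn; apply: assoc_idealM.
Qed.

Definition bracket_ideal L : set P := mul_space (pbr_space L [set: P]) [set: P].

Lemma bracket_ideal_min L I : assoc_ideal I ->
  (forall a x, L a -> I (pbr a x)) -> bracket_ideal L `<=` I.
Proof.
move=> idI LI; have Ilin := assoc_ideal_linear I idI.
apply: lspan_min => // _ [u Lu [v _ <-]]; apply: assoc_idealMr => //.
by apply: pbr_space_min Lu => // a x La _; apply: LI.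
Qed.

Lemma mem_bracket_ideal L a x : L a -> bracket_ideal L (pbr a x).
Proof.
move=> La; apply: sub_lspan; exists (pbr a x); first exact: mem_pbr_space.
by exists 1; rewrite ?mulr1.
Qed.

Lemma bracket_ideal_assoc L : assoc_ideal (bracket_ideal L).
Proof.
have [J0 Jlin] := lspan_linear [set a * b | a in pbr_space L [set: P] & b in [set: P]].
split=> // [x y Jx Jy|a x].
  by rewrite -[x]scale1r; apply: Jlin.
apply: (lspan_min _ [set x | bracket_ideal L (a * x)]).
  split=> [|k u v Ju Jv] /=; first by rewrite mulr0.
  by rewrite mulrDr -scalerAr; apply: Jlin.
move=> _ [u Lu [v _ <-]] /=; apply: sub_lspan; exists u => //; exists (v * a) => //.
by rewrite mulrA mulrC.
Qed.

Lemma pbr_ideal_poisson : poisson_ideal (pbr_ideal P).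
Proof.
have idJ := bracket_ideal_assoc [set: P].
have [J0 Jlin] := assoc_ideal_linear _ idJ.
split=> // [a x|a x _]; first exact: (assoc_idealM _ idJ).
exact: mem_bracket_ideal.
Qed.

(** * Generators modulo the next term of the series *)

(** The Leibniz rule turns two central elements modulo [I] that differ by a
    factor [a] into a product that vanishes modulo [I]. *)
Lemma ideal_pbr_mul_factor I a c z : assoc_ideal I ->
  I (pbr (a * c) z) -> I (pbr c z) -> I (c * pbr a z).
Proof.
move=> idI; rewrite pbr_leibniz addrC => Iacz Icz.
by apply: (assoc_idealBr _ idI) Iacz _; apply: assoc_idealM.
Qed.

(** The factor [a] commutes with the derivation [pbr a], so [pbr a (a * x)] and
    [pbr a x] are central elements that differ by that factor. *)
Lemma pbr_sqr_mod_center I a : assoc_ideal I ->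
  (forall x z, I (pbr (pbr a x) z)) -> forall x, I (pbr a x ^+ 2).
Proof.
move=> idI Icentral x; rewrite expr2; apply: ideal_pbr_mul_factor => //.
by have := Icentral (a * x) x; rewrite pbrMr pbr_alt mulr0 addr0.
Qed.

(** As [pbr a] kills [a], the square of this derivation sends [a * x] to [a]
    times its value at [x], which yields [D2D]; the cube then appears as the
    middle Leibniz term of that square at [x * x]. *)
Lemma pbr_cube_mod_center I a : (2%:R : F) != 0 -> assoc_ideal I ->
  (forall x z, I (pbr (pbr a (pbr a x)) z)) -> forall x, I (pbr a x ^+ 3).
Proof.
move=> F2 idI Icentral x.
have D2D y : I (pbr a (pbr a y) * pbr a x).
  apply: ideal_pbr_mul_factor => //.
  by have := Icentral (a * y) x; rewrite !(pbrMr, pbr_alt, mulr0, addr0).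
have D2xx : pbr a (pbr a (x * x)) * pbr a x =
    2%:R *: pbr a x ^+ 3 + 2%:R *: (x * (pbr a (pbr a x) * pbr a x)).
  rewrite pbrMr pbrDr pbrMr -mulr2n -scaler_nat -scalerAl mulrDl scalerDr addrC.
  by rewrite mulrA !exprS expr0 mulr1 mulrA.
have := D2D (x * x); rewrite D2xx => /(assoc_idealBr _ idI) I2Dx3.
rewrite -(scalerK F2 (pbr a x ^+ 3)); apply: assoc_idealZ => //; apply: I2Dx3.
by apply: assoc_idealZ => //; apply: assoc_idealM.
Qed.

Lemma derived_series_lie_ideal n a x :
  derived_series n a -> derived_series n (pbr a x).
Proof.
elim: n a x => // n IHn a x; have [D0 Dlin] := lspan_linear
  [set pbr a b | a in derived_series n & b in derived_series n].
apply: (pbr_space_min _ _ [set a | derived_series n.+1 (pbr a x)]).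
  split=> [|k u v Du Dv] /=; first by rewrite pbr0l.
  by rewrite pbrDl pbrZl; apply: Dlin.
move=> u v Du Dv /=; rewrite pbr_jacobi_der -[pbr (pbr u x) v]scale1r.
by apply: Dlin; apply: mem_pbr_space => //; apply: IHn.
Qed.

Lemma derived_pbr_cube n a x : (2%:R : F) != 0 -> derived_series n a ->
  bracket_ideal (derived_series n.+1) (pbr a x ^+ 3).
Proof.
move=> F2 Da; apply: pbr_cube_mod_center => // [|y z].
  exact: bracket_ideal_assoc.
apply: mem_bracket_ideal; apply: mem_pbr_space => //.
exact: derived_series_lie_ideal.
Qed.

Lemma lower_central_pbr_sqr n a x : lower_central_series n a ->
  bracket_ideal (lower_central_series n.+1) (pbr a x ^+ 2).
Proof.
move=> Ca; apply: pbr_sqr_mod_center => [|y z].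
  exact: bracket_ideal_assoc.
by apply: mem_bracket_ideal; apply: mem_pbr_space.
Qed.

(** * Climbing down the series *)

Section Series.
Variables (S : nat -> set P) (n : nat).
Hypotheses (S0 : S 0%N = [set: P]) (Sn : S n = [set 0]).

Lemma bracket_ideal_last x : bracket_ideal (S n) x -> x = 0.
Proof.
rewrite Sn; apply: (bracket_ideal_min _ [set 0] zero_assoc_ideal) => a y ->.
exact: pbr0l.
Qed.

Lemma series_nil :
  (forall k a x, S k a -> radical (bracket_ideal (S k.+1)) (pbr a x)) ->
  nil_ideal (pbr_ideal P).
Proof.
move=> Snil; split=> [|x]; first exact: pbr_ideal_poisson.
rewrite -[pbr_ideal P]/(bracket_ideal [set: P]) -{1}S0 => Jx.
suff [r /bracket_ideal_last xr0] : radical (bracket_ideal (S n)) x.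
  by exists r.+1; rewrite exprS xr0 mulr0.
elim: n => [|k [r]]; first by exists 1%N; rewrite expr1.
have idR := radical_ideal _ (bracket_ideal_assoc (S k.+1)).
move=> /(bracket_ideal_min _ _ idR (Snil k))[s]; rewrite -exprM => Jxrs.
by exists (r * s)%N.
Qed.

(** Each step down costs one Frobenius power, hence the exponent [p ^ n]. *)
Lemma series_nil_bounded p : p \in [pchar F] ->
  (forall k a x, S k a -> bracket_ideal (S k.+1) (pbr a x ^+ p)) ->
  nil_bounded_index (pbr_ideal P).
Proof.
move=> Fp Snil; split; first exact: pbr_ideal_poisson.
exists (p ^ n)%N; split=> [|x].
  by rewrite expn_gt0 prime_gt0 ?(pcharf_prime Fp).
rewrite -[pbr_ideal P]/(bracket_ideal [set: P]) -{1}S0 => Jx; apply: bracket_ideal_last.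
elim: n => [|k]; first by rewrite expn0.
have idJ := bracket_ideal_assoc (S k.+1).
have idX := frobenius_preimage_ideal p _ Fp idJ.
by move=> /(bracket_ideal_min _ _ idX (Snil k)) /=; rewrite -exprM -expnSr.
Qed.

End Series.

End NilBrackets.

Theorem theorem3p6 (F : fieldType) (p : nat) (P : poissonAlgType F)
    (hp : has_pchar F p) :
  [/\ poisson_solvable P -> p <> 2 -> nil_ideal (pbr_ideal P),
      poisson_solvable P -> 3 <= p -> nil_bounded_index (pbr_ideal P)
    & lie_nilpotent P -> 0 < p -> nil_bounded_index (pbr_ideal P)].
Proof.
have F2 : p <> 2 -> (2%:R != 0 :> F)%R.
  move=> p_neq2; apply/negP => F2_0; have F2 : 2 \in [pchar F]%R by apply/andP.
  case: p hp p_neq2 => [Fp|p Fp []]; first by rewrite Fp in F2.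
  by move: F2; rewrite (GRing.pcharf_eq Fp) inE => /eqP.
have Fp : 0 < p -> p \in [pchar F]%R by case: p hp {F2}.
split=> [[n Dn] p_neq2|[n Dn] p_ge3|[n Cn] p_gt0].
- apply: (series_nil (@derived_series F P) n) => // k a x Da.
  by exists 3; apply: derived_pbr_cube => //; apply: F2.
- have p_gt0 : 0 < p by apply: leq_trans p_ge3.
  apply: (series_nil_bounded (@derived_series F P) n _ _ p) => // [|k a x Da].
    exact: Fp.
  apply: (assoc_idealX _ (bracket_ideal_assoc _) _ _ _ p_ge3).
  by apply: derived_pbr_cube => //; apply: F2 => p2; rewrite p2 in p_ge3.
- have pP := Fp p_gt0.
  apply: (series_nil_bounded (@lower_central_series F P) n _ _ p) => // k a x Ca.
  apply: (assoc_idealX _ (bracket_ideal_assoc _) _ 2); last first.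
    exact: lower_central_pbr_sqr.
  by apply/prime_gt1/(GRing.pcharf_prime pP).
Qed.
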